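(* Let $R$ be the Rado graph and let $\mathcal{F}=\{F_i : i\in\mathbb{N}\}$ be a countably infinite family (not necessarily pairwise non-isomorphic) of countable graphs, each having at least one edge. Then there exists a factorization $\{\Gamma_i: i\in\mathbb{N}\}$ of $R$ with $\Gamma_i$ isomorphic to $F_i$ for every $i$ if and only if the domination number of each graph $F_i$ is infinite (i.e. no $F_i$ has a finite dominating set).
   Context: All graphs are simple. The Rado graph $R$ is the graph with vertex set $\mathbb{N}=\{0,1,2,\dots\}$ in which $\{i,j\}$ with $i<j$ is an edge iff the $i$-th bit (counting from the least significant bit, which is bit $0$) of the binary expansion of $j$ is $1$. A factor of a graph $\Lambda$ is a spanning subgraph (same vertex set as $\Lambda$). A factorization of $\Lambda$ is a family of factors of $\Lambda$ whose edge sets partition $E(\Lambda)$. A set $D$ of vertices is dominating if every vertex not in $D$ is adjacent to some vertex of $D$; the domination number is the minimum cardinality of a dominating set. *)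

(* Defs.v *)
From mathcomp Require Import all_boot.
From mathcomp Require Import boolp classical_sets cardinality.

Set Implicit Arguments.
Unset Strict Implicit.
Unset Printing Implicit Defensive.

Local Open Scope classical_set_scope.

Record sgraph (V : Type) := SGraph {
  adj : V -> V -> Prop;
  adj_sym : forall x y, adj x y -> adj y x;
  adj_irr : forall x, ~ adj x x
}.

Definition edges (V : Type) (G : sgraph V) : set (set V) :=
  [set e | exists x y, adj G x y /\ e = [set x; y]].

Definition isomorphic (V W : Type) (G : sgraph V) (H : sgraph W) : Prop :=
  exists f : V -> W,
    bijective f /\ forall x y, adj G x y <-> adj H (f x) (f y).

(* The vertex set is the carrier type, so every [G : sgraph V] is spanning. *)
Definition factor (V : Type) (L G : sgraph V) : Prop :=
  edges G `<=` edges L.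

(* [partition] is the one of classical_sets: cover, pairwise disjointness for
   distinct indices, and nonempty parts. *)
Definition factorization (V I : Type) (L : sgraph V) (G : I -> sgraph V) : Prop :=
  (forall i, factor L (G i)) /\
  classical_sets.partition [set: I] (fun i => edges (G i)) (edges L).

Definition dominating (V : Type) (G : sgraph V) (D : set V) : Prop :=
  forall x, ~ D x -> exists y, D y /\ adj G x y.

Definition infinite_domination_number (V : Type) (G : sgraph V) : Prop :=
  forall D : set V, dominating G D -> infinite_set D.

(* The coefficient of 2 ^ i in the binary expansion of n. *)
Definition bit (i n : nat) : bool := odd (n %/ 2 ^ i).

Definition rado_adj (i j : nat) : Prop :=
  (i < j /\ bit i j) \/ (j < i /\ bit j i).

Lemma rado_adj_sym i j : rado_adj i j -> rado_adj j i.
Proof. by case=> ?; [right | left]. Qed.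

Lemma rado_adj_irr i : ~ rado_adj i i.
Proof. by case=> -[]; rewrite ltnn. Qed.

Definition rado : sgraph nat := SGraph rado_adj_sym rado_adj_irr.

(* Main.v *)
Require Import Defs.
From mathcomp Require Import all_boot.
From mathcomp Require Import boolp classical_sets cardinality.
From mathcomp Require Import functions.

Set Implicit Arguments.
Unset Strict Implicit.
Unset Printing Implicit Defensive.

Local Open Scope classical_set_scope.

(** The vertex [2 ^ m] of the Rado graph is adjacent to no [d < m], so a finite
    set dominates no factor.

    Conversely, the [F i] are embedded simultaneously by a back-and-forth over
    finite families of finite partial injections.  A vertex of [F i] is sent to
    some unused [2 ^ B - 1], which is adjacent to every number below [B]; a
    number is given as preimage a vertex of [F i] outside the current finite
    domain with no neighbour there, which creates no edge and exists because
    that domain is not dominating; an uncovered edge of the Rado graph becomes the image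
    of an edge of some [F i] that has not been touched yet. *)

(** * Edges as unordered pairs *)

Lemma set2_eq_inv (T : Type) (a b c d : T) :
  [set a; b] = [set c; d] -> (a = c /\ b = d) \/ (a = d /\ b = c).
Proof.
move=> e.
have [a2 b2] : [set c; d] a /\ [set c; d] b by rewrite -e; split; [left|right].
have [c2 d2] : [set a; b] c /\ [set a; b] d by rewrite e; split; [left|right].
by case: a2 b2 c2 d2 => /= ? [] /= ? [] /= ? [] /= ?; subst; tauto.
Qed.

(** Lets the conditions on edge sets in [factor] and [partition] be read as conditions on
    adjacency. *)
Lemma edges_set2 (V : Type) (G : sgraph V) (x y : V) :
  edges G [set x; y] <-> adj G x y.
Proof.
split=> [[x' [y' [Gxy' e]]]|Gxy]; last by exists x, y.
by case: (set2_eq_inv e) => -[-> ->] //; apply: adj_sym.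
Qed.

Lemma factorP (V : Type) (L G : sgraph V) :
  factor L G <-> forall x y, adj G x y -> adj L x y.
Proof.
split=> [GL x y /edges_set2 /GL /edges_set2 //|GL _ [x [y [Gxy ->]]]].
exact/edges_set2/GL.
Qed.

(** * Binary digits and adjacency in the Rado graph *)

Lemma bit_exp2 (i m : nat) : i < m -> bit i (2 ^ m) = false.
Proof.
move=> ltim; rewrite /bit -expnB ?(ltnW ltim) // oddX /= orbF.
by apply/negbTE; rewrite -lt0n subn_gt0.
Qed.

Lemma bit_exp2_pred (i m : nat) : i < m -> bit i (2 ^ m).-1.
Proof.
move=> ltim; rewrite /bit -(subnK (ltnW ltim)) expnD.
have d0 : 0 < m - i by rewrite subn_gt0.
(* Division with remainder by [2 ^ i]: the quotient [(2 ^ (m - i)).-1] is odd because [m - i] is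
   positive. *)
have -> : (2 ^ (m - i) * 2 ^ i).-1 = (2 ^ (m - i)).-1 * 2 ^ i + (2 ^ i).-1.
  have := expn_gt0 2 i; have := expn_gt0 2 (m - i).
  case: (2 ^ i) => // b; case: (2 ^ (m - i)) => // a _ _.
  by rewrite mulSn addSn addnC.
rewrite divnMDl ?expn_gt0 // divn_small ?addn0; last first.
  by rewrite prednK ?expn_gt0.
by rewrite -subn1 oddB ?expn_gt0 // oddX orbF addbT -lt0n.
Qed.

Lemma rado_exp2 (i m : nat) : i < m -> ~ rado_adj (2 ^ m) i.
Proof.
move=> ltim [[lt_mi _]|[_]]; last by rewrite bit_exp2.
by have := ltn_trans (ltn_trans (ltn_expl m (ltnSn 1)) lt_mi) ltim; rewrite ltnn.
Qed.

Lemma rado_exp2_pred (i m : nat) : i < m -> rado_adj i (2 ^ m).-1.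
Proof.
move=> ltim; left; split; last exact: bit_exp2_pred.
by apply: leq_trans ltim _; rewrite -ltnS prednK ?expn_gt0 // ltn_expl.
Qed.

Lemma seq_ubound (T : eqType) (f : T -> nat) (s : seq T) :
  exists B, forall x, x \in s -> f x < B.
Proof. by exists (\max_(x <- s) f x).+1 => x xs; rewrite ltnS leq_bigmax_seq. Qed.

(** * Necessity, and transfer along isomorphisms *)

Lemma rado_factor_infinite_domination (G : sgraph nat) :
  factor rado G -> infinite_domination_number G.
Proof.
move=> /factorP Grado D domD /finite_seqP[s Ds].
have [B sB] := seq_ubound (fun x => x) s.
have : ~ D (2 ^ B).
  by rewrite Ds /= => /sB; rewrite ltnNge ltnW // ltn_expl.
move=> /domD[y [+ /Grado]]; rewrite Ds /= => /sB.
exact: rado_exp2.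
Qed.

Lemma isomorphic_infinite_domination (V W : Type) (G : sgraph V) (H : sgraph W) :
  isomorphic G H -> infinite_domination_number G -> infinite_domination_number H.
Proof.
move=> [f [[g fK gK] fP]] infG D domD finD.
(* The preimage of [D] under [f] is written as its image under [g], since images of finite sets are
   finite. *)
apply: (infG (g @` D)); last exact: finite_image.
move=> x gDx; have /domD[y [Dy fxy]] : ~ D (f x).
  by move=> Dfx; apply: gDx; exists (f x).
by exists (g y); split; [exists y | apply/fP; rewrite gK].
Qed.

Lemma isomorphic_sym (V W : Type) (G : sgraph V) (H : sgraph W) :
  isomorphic G H -> isomorphic H G.
Proof.
move=> [f [[g fK gK] fP]]; exists g; split; first by exists f.
by move=> x y; rewrite fP !gK.
Qed.

Lemma isomorphic_trans (U V W : Type)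
    (G : sgraph U) (H : sgraph V) (K : sgraph W) :
  isomorphic G H -> isomorphic H K -> isomorphic G K.
Proof.
move=> [f [bf fP]] [g [bg gP]]; exists (g \o f); split; first exact: bij_comp.
by move=> x y; rewrite fP gP.
Qed.

(** The whole vertex set is vacuously dominating, hence infinite; being countable, it is in
    bijection with [nat], and adjacency is pulled back. *)
Lemma isomorphic_nat (V : Type) (G : sgraph V) :
  countable [set: V] -> infinite_domination_number G ->
  exists H : sgraph nat, isomorphic H G.
Proof.
move=> cV infG.
have infV : infinite_set [set: V] by apply: infG => x /(_ I).
have /card_set_bijP[f] := eq_card_nat cV infV.
rewrite setTT_bijective => -[g fK gK].
exists (@SGraph nat (fun m n => adj G (g m) (g n))
          (fun _ _ => @adj_sym _ G _ _) (fun _ => @adj_irr _ G _)).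
by exists g; split; first by exists f.
Qed.

(** * Finite packings and their extensions *)

Lemma infinite_domination_isolated (G : sgraph nat) (s : seq nat) :
  infinite_domination_number G ->
  exists v, v \notin s /\ forall u, u \in s -> ~ adj G v u.
Proof.
move=> infG; apply: contrapT => nov; apply: (infG [set` s]); last exact: finite_seq.
move=> x /= /negP xs; apply: contrapT => nox; apply: nov; exists x; split=> // u us xu.
by apply: nox; exists u.
Qed.

(* A triple [(i, v, n)] says that the vertex [v] of [F i] is sent to [n]. *)
Definition state := seq (nat * nat * nat).

(** Non-edges of [F i] may land on edges, since a factor need not be induced. Different indices may
    share numbers, as they must in the limit, but not edges. [packed_disj] compares equally oriented
    pairs only; the other orientation follows by symmetry of [adj]. *)
Record packed (F : nat -> sgraph nat) (s : state) : Prop := Packed {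
  packed_fun : forall i v m n, (i, v, m) \in s -> (i, v, n) \in s -> m = n;
  packed_inj : forall i u v n, (i, u, n) \in s -> (i, v, n) \in s -> u = v;
  packed_rado : forall i u v m n, (i, u, m) \in s -> (i, v, n) \in s ->
    adj (F i) u v -> rado_adj m n;
  packed_disj : forall i j u v u' v' m n,
    (i, u, m) \in s -> (i, v, n) \in s -> adj (F i) u v ->
    (j, u', m) \in s -> (j, v', n) \in s -> adj (F j) u' v' -> i = j
}.

Definition covered (F : nat -> sgraph nat) (s : state) (m n : nat) :=
  exists i u v, [/\ (i, u, m) \in s, (i, v, n) \in s & adj (F i) u v].

Lemma packed_add_domain F s i v : packed F s ->
  exists s' : state, [/\ {subset s <= s'}, packed F s' & exists n, (i, v, n) \in s'].
Proof.
move=> ps; have [[n ins]|nov] := pselect (exists n, (i, v, n) \in s).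
  by exists s; split=> //; exists n.
(* All numbers in use are below [B], hence adjacent to [n], while [n >= B] makes [n] new. *)
have [B sB] := seq_ubound (fun t => t.2) s.
pose n := (2 ^ B).-1.
have fresh j u : (j, u, n) \in s -> False.
  move=> /sB /=; rewrite ltnNge => /negP; apply.
  by rewrite -ltnS prednK ?expn_gt0 // ltn_expl.
have radon j u m : (j, u, m) \in s -> rado_adj m n.
  by move=> /sB; apply: rado_exp2_pred.
exists ((i, v, n) :: s); split; first by move=> t ts; rewrite inE ts orbT.
- split.
  + move=> j u m m'; rewrite !inE => /predU1P[[-> -> ->]|+] /predU1P[].
    * by case.
    * by move=> h; case: nov; exists m'.
    * by move=> h [ji uv _]; case: nov; exists m; rewrite -ji -uv.
    * exact: (packed_fun ps).
  + move=> j u u' m; rewrite !inE => /predU1P[[-> -> ->]|+] /predU1P[].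
    * by case.
    * by move=> /fresh.
    * by move=> h [_ _ mn]; rewrite mn in h; case: (fresh _ _ h).
    * exact: (packed_inj ps).
  + move=> j u u' m m'; rewrite !inE => /predU1P[[-> -> ->]|+] /predU1P[].
    * by move=> [-> _] vv; case: (adj_irr vv).
    * by move=> h _; apply: rado_adj_sym (radon _ _ _ h).
    * by move=> h [_ _ ->] _; apply: radon h.
    * exact: (packed_rado ps).
  + move=> j k u u' w w' m m'; rewrite !inE.
    (* The number [n] occurs only in the new triple, so an edge ending there forces both indices to
       be [i]; otherwise all four triples are old. *)
    move=> /predU1P[[-> _ ->] _ _ /predU1P[[]|/fresh]//|sj].
    move=> /predU1P[[-> _ ->] _ _ /predU1P[[]|/fresh]//|sj'].
    move=> jE /predU1P[[_ _ mn]|sk]; first by move: sj; rewrite mn => /fresh.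
    move=> /predU1P[[_ _ mn]|sk']; first by move: sj'; rewrite mn => /fresh.
    exact: (packed_disj ps) sj sj' jE sk sk'.
- by exists n; rewrite inE eqxx.
Qed.

(** Here [n] is prescribed and may already be used by other indices, so the freedom lies in [v]: it
    completes no edge, and the last two conditions of [packed] are inherited. *)
Lemma packed_add_codomain F s i n :
  (forall i, infinite_domination_number (F i)) -> packed F s ->
  exists s' : state, [/\ {subset s <= s'}, packed F s' & exists v, (i, v, n) \in s'].
Proof.
move=> infF ps; have [[v ins]|nov] := pselect (exists v, (i, v, n) \in s).
  by exists s; split=> //; exists v.
have [v [+ vE]] := infinite_domination_isolated
  [seq t.1.2 | t <- s & t.1.1 == i] (infF i).
have dom u m : (i, u, m) \in s -> u \in [seq t.1.2 | t <- s & t.1.1 == i].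
  by move=> h; apply/mapP; exists (i, u, m) => //; rewrite mem_filter eqxx.
move=> vdom.
have fresh m : (i, v, m) \in s -> False by move=> /dom; apply/negP.
have isol u m : (i, u, m) \in (i, v, n) :: s -> ~ adj (F i) v u.
  rewrite inE => /predU1P[[-> _]|/dom /vE //]; exact: adj_irr.
have isol' u m : (i, u, m) \in (i, v, n) :: s -> ~ adj (F i) u v.
  by move=> /isol vu uv; apply/vu/adj_sym.
exists ((i, v, n) :: s); split; first by move=> t ts; rewrite inE ts orbT.
- split.
  + move=> j u m m'; rewrite !inE => /predU1P[[-> -> ->]|+] /predU1P[].
    * by case.
    * by move=> /fresh.
    * by move=> h [ji uv _]; rewrite ji uv in h; case: (fresh _ h).
    * exact: (packed_fun ps).
  + move=> j u u' m; rewrite !inE => /predU1P[[-> -> ->]|+] /predU1P[].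
    * by case.
    * by move=> h; case: nov; exists u'.
    * by move=> h [ji _ mn]; case: nov; exists u; rewrite -ji -mn.
    * exact: (packed_inj ps).
  + move=> j u u' m m' su su' jE.
    move: (su) (su'); rewrite !inE => /predU1P[[ji uv _]|ju].
      by subst j u; case: (isol _ _ su' jE).
    move=> /predU1P[[ji uv _]|ju']; first by subst j u'; case: (isol' _ _ su jE).
    exact: (packed_rado ps) ju ju' jE.
  + have old j u u' m m' : (j, u, m) \in (i, v, n) :: s ->
        (j, u', m') \in (i, v, n) :: s -> adj (F j) u u' ->
        (j, u, m) \in s /\ (j, u', m') \in s.
      move=> su su' jE; move: (su) (su'); rewrite !inE => /predU1P[[ji uv _]|ju].
        by subst j u; case: (isol _ _ su' jE).
      move=> /predU1P[[ji uv _]|//]; first by subst j u'; case: (isol' _ _ su jE).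
    move=> j k u u' w w' m m' sj sj' jE sk sk' kE.
    have [{}sj {}sj'] := old _ _ _ _ _ sj sj' jE.
    have [{}sk {}sk'] := old _ _ _ _ _ sk sk' kE.
    exact: (packed_disj ps) sj sj' jE sk sk' kE.
- by exists v; rewrite inE eqxx.
Qed.

Lemma packed_add_edge F s m n :
  (forall i, exists x y, adj (F i) x y) -> packed F s -> rado_adj m n ->
  exists s' : state, [/\ {subset s <= s'}, packed F s' & covered F s' m n].
Proof.
move=> Fedge ps Rmn; have [cov|uncov] := pselect (covered F s m n); first by exists s; split.
(* Only finitely many indices occur in [s]; [i] lies beyond them, so its partial map is still
   empty. *)
have [i sB] := seq_ubound (fun t => t.1.1) s.
have fresh u k : (i, u, k) \in s -> False by move=> /sB; rewrite ltnn.
have [x [y xy]] := Fedge i.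
have nxy : x <> y by move=> e; rewrite e in xy; case: (adj_irr xy).
have nmn : m <> n by move=> e; rewrite e in Rmn; case: (rado_adj_irr Rmn).
have new u k : (i, u, k) \in [:: (i, x, m), (i, y, n) & s] ->
    (u = x /\ k = m) \/ (u = y /\ k = n).
  by rewrite !inE => /predU1P[[-> ->]|/predU1P[[-> ->]|/fresh]//]; [left|right].
have old j u k : j <> i -> (j, u, k) \in [:: (i, x, m), (i, y, n) & s] ->
    (j, u, k) \in s.
  by move=> ji; rewrite !inE => /predU1P[[]//|/predU1P[[]//|]].
exists [:: (i, x, m), (i, y, n) & s]; split.
- by move=> t ts; rewrite !inE ts !orbT.
- split.
  + move=> j u k k'; have [->|/eqP ji] := eqVneq j i.
      by move=> /new[][-> ->] /new[][] // e; rewrite e in nxy.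
    by move=> /(old _ _ _ ji) + /(old _ _ _ ji); apply: (packed_fun ps).
  + move=> j u u' k; have [->|/eqP ji] := eqVneq j i.
      by move=> /new[][-> ->] /new[][] // -> e; rewrite e in nmn.
    by move=> /(old _ _ _ ji) + /(old _ _ _ ji); apply: (packed_inj ps).
  + move=> j u u' k k'; have [->|/eqP ji] := eqVneq j i.
      move=> /new[][-> ->] /new[][-> ->] uu; do ?[by case: (adj_irr uu)].
        by [].
      exact: rado_adj_sym.
    by move=> /(old _ _ _ ji) + /(old _ _ _ ji); apply: (packed_rado ps).
  (* An edge of index [i] has image [m], [n] in one of the two orders; an edge of another index with
     the same image is old and would make [covered F s m n] true. *)
  + have excl j u u' w w' k k' : j <> i ->
        (i, w, k) \in [:: (i, x, m), (i, y, n) & s] ->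
        (i, w', k') \in [:: (i, x, m), (i, y, n) & s] -> adj (F i) w w' ->
        (j, u, k) \in [:: (i, x, m), (i, y, n) & s] ->
        (j, u', k') \in [:: (i, x, m), (i, y, n) & s] -> adj (F j) u u' -> False.
      move=> ji si si' iE /(old _ _ _ ji) sj /(old _ _ _ ji) sj' jE.
      apply: uncov; move: si si' iE sj sj'.
      move=> /new[][-> ->] /new[][-> ->] ww sj sj'; do ?[by case: (adj_irr ww)].
        by exists j, u, u'.
      by exists j, u', u; split=> //; apply: adj_sym.
    move=> j k u u' w w' a b sj sj' jE sk sk' kE.
    have [ji|/eqP ji] := eqVneq j i; have [ki|/eqP ki] := eqVneq k i.
    * by rewrite ji ki.
    * by subst j; case: (excl _ _ _ _ _ _ _ ki sj sj' jE sk sk' kE).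
    * by subst k; case: (excl _ _ _ _ _ _ _ ji sk sk' kE sj sj' jE).
    * exact: (packed_disj ps) (old _ _ _ ji sj) (old _ _ _ ji sj') jE
        (old _ _ _ ki sk) (old _ _ _ ki sk') kE.
- by exists i, x, y; rewrite !inE !eqxx /= orbT.
Qed.

(** One pair serves three requests: vertex [b] of [F a], number [b] for index [a], and the edge [a],
    [b] if present. A single enumeration of pairs therefore suffices. *)
Lemma packed_step F s a b :
  (forall i, infinite_domination_number (F i)) ->
  (forall i, exists x y, adj (F i) x y) -> packed F s ->
  exists s' : state, [/\ {subset s <= s'}, packed F s', exists n, (a, b, n) \in s',
    exists v, (a, v, b) \in s' & rado_adj a b -> covered F s' a b].
Proof.
move=> infF Fedge ps.
have [s1 [ss1 ps1 [n dn]]] := packed_add_domain a b ps.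
have [s2 [ss2 ps2 [v dv]]] := packed_add_codomain a b infF ps1.
have [Rab|nRab] := pselect (rado_adj a b); last first.
  exists s2; split=> //; [|by exists n; apply: ss2|by exists v].
  by move=> t /ss1 /ss2.
have [s3 [ss3 ps3 cov]] := packed_add_edge Fedge ps2 Rab.
exists s3; split=> //; [|by exists n; apply/ss3/ss2|by exists v; apply: ss3].
by move=> t /ss1 /ss2 /ss3.
Qed.

(** * The limit of the packings *)

Lemma packed_limit F :
  (forall i, infinite_domination_number (F i)) ->
  (forall i, exists x y, adj (F i) x y) ->
  exists S : nat -> state, [/\ forall k, packed F (S k),
    forall k l, k <= l -> {subset S k <= S l},
    forall i v, exists k n, (i, v, n) \in S k,
    forall i n, exists k v, (i, v, n) \in S k &
    forall m n, rado_adj m n -> exists k, covered F (S k) m n].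
Proof.
move=> infF Fedge.
(* The premise [packed F p.1] stays inside the choice so that [f] is total; on other states the
   value is arbitrary. *)
have /choice[f fP] : forall p : state * (nat * nat), exists s' : state,
    packed F p.1 -> [/\ {subset p.1 <= s'}, packed F s',
      exists n : nat, (p.2.1, p.2.2, n) \in s', exists v : nat, (p.2.1, v, p.2.2) \in s' &
      rado_adj p.2.1 p.2.2 -> covered F s' p.2.1 p.2.2].
  move=> [s [a b]] /=; have [ps|nps] := pselect (packed F s); last by exists s.
  by have [s' ?] := packed_step a b infF Fedge ps; exists s'.
(* Numbers encoding no pair get the default [(0, 0)], a harmless extra request. *)
pose code k : nat * nat := odflt (0, 0) (unpickle k).
pose S := fix S k : state := if k is k'.+1 then f (S k', code k') else [::].
have pS k : packed F (S k).
  by elim: k => [|k /= pk]; [split | have [] := fP (S k, code k) pk].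
have step (a b : nat) := fP (S (pickle (a, b)), code (pickle (a, b))) (pS _).
have codeK (a b : nat) : code (pickle (a, b)) = (a, b) by rewrite /code pickleK.
exists S; split=> //.
- move=> k l /subnK <-; elim: (l - k) => // d IH t /IH.
  by rewrite addSn /=; have [+ _ _ _ _] := fP (S (d + k), code (d + k)) (pS _); apply.
(* The pair is treated in passing from stage [pickle (i, v)] to its successor. *)
- move=> i v; exists (pickle (i, v)).+1.
  by have [_ _ + _ _] := step i v; rewrite /= codeK.
- move=> i n; exists (pickle (i, n)).+1.
  by have [_ _ _ + _] := step i n; rewrite /= codeK.
- move=> m n Rmn; exists (pickle (m, n)).+1.
  by have [_ _ _ _ +] := step m n; rewrite /= codeK; apply.
Qed.

(** The union of the states is, for each [i], the graph of a bijection of [nat]. Every condition of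
    [packed] concerns finitely many triples, and these lie together in one state of the chain. *)
Lemma rado_factorization_nat (F : nat -> sgraph nat) :
  (forall i, infinite_domination_number (F i)) ->
  (forall i, exists x y, adj (F i) x y) ->
  exists G : nat -> sgraph nat,
    factorization rado G /\ forall i, isomorphic (G i) (F i).
Proof.
move=> infF Fedge; have [S [pS monoS domS codS covS]] := packed_limit infF Fedge.
pose Phi i v n := exists k, (i, v, n) \in S k.
have common t1 t2 k1 k2 : t1 \in S k1 -> t2 \in S k2 ->
    exists k, t1 \in S k /\ t2 \in S k.
  move=> h1 h2; exists (maxn k1 k2).
  by split; [apply: monoS h1; apply: leq_maxl | apply: monoS h2; apply: leq_maxr].
have /choice[phi phiP] : forall p : nat * nat, exists n, Phi p.1 p.2 n.
  by move=> [i v]; have [k [n ?]] := domS i v; exists n, k.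
have /choice[psi psiP] : forall p : nat * nat, exists v, Phi p.1 v p.2.
  by move=> [i n]; have [k [v ?]] := codS i n; exists v, k.
have phiE i v n : Phi i v n <-> phi (i, v) = n.
  split=> [[k h]|<-]; last exact: (phiP (i, v)).
  have [k' /= h'] := phiP (i, v); have [l [h1 h2]] := common _ _ _ _ h' h.
  exact: (packed_fun (pS l)) h1 h2.
have psiE i v n : Phi i v n <-> psi (i, n) = v.
  split=> [[k h]|<-]; last exact: (psiP (i, n)).
  have [k' /= h'] := psiP (i, n); have [l [h1 h2]] := common _ _ _ _ h' h.
  exact: (packed_inj (pS l)) h1 h2.
have phiK i v : psi (i, phi (i, v)) = v by apply/psiE/phiE.
have psiK i n : phi (i, psi (i, n)) = n by apply/phiE/psiE.
(* Pulling [F i] back along the inverse map makes [psi] itself the isomorphism onto [F i]. *)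
pose G i := @SGraph nat (fun m n => adj (F i) (psi (i, m)) (psi (i, n)))
  (fun _ _ => @adj_sym _ (F i) _ _) (fun _ => @adj_irr _ (F i) _).
have in_state i j m n : exists k, [/\ (i, psi (i, m), m) \in S k,
    (i, psi (i, n), n) \in S k, (j, psi (j, m), m) \in S k &
    (j, psi (j, n), n) \in S k].
  have [k1 h1] := psiP (i, m); have [k2 h2] := psiP (i, n).
  have [k3 h3] := psiP (j, m); have [k4 h4] := psiP (j, n).
  exists (maxn (maxn k1 k2) (maxn k3 k4)).
  by split; [apply: monoS h1|apply: monoS h2|apply: monoS h3|apply: monoS h4];
    rewrite !leq_max leqnn ?orbT.
have Grado i m n : adj (G i) m n -> rado_adj m n.
  have [k [h1 h2 _ _]] := in_state i i m n.
  exact: (packed_rado (pS k)) h1 h2.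
exists G; split; last first.
  move=> i; exists (fun n => psi (i, n)); split=> //.
  by exists (fun v => phi (i, v)) => v; rewrite ?phiK ?psiK.
have Gfactor i : factor rado (G i) by apply/factorP/Grado.
split=> //; split.
- apply/seteqP; split=> [e [i _ /Gfactor]//|_ [m [n [Rmn ->]]]].
  have [k [i [u [v [hu hv uv]]]]] := covS _ _ Rmn.
  exists i => //; apply/edges_set2 => /=.
  have /psiE -> : Phi i u m by exists k.
  by have /psiE -> : Phi i v n by exists k.
- move=> i j _ _ [_ [[m [n [iE ->]]] /edges_set2 jE]].
  have [k [h1 h2 h3 h4]] := in_state i j m n.
  exact: (packed_disj (pS k)) h1 h2 iE h3 h4 jE.
(* Parts of a [partition] must be nonempty; the image of any edge of [F i] is a member. *)
- move=> i _; have [x [y xy]] := Fedge i.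
  by exists [set phi (i, x); phi (i, y)]; apply/edges_set2; rewrite /= !phiK.
Qed.

Theorem theorem1p3 (V : nat -> Type) (F : forall i : nat, sgraph (V i))
    (V_countable : forall i : nat, countable [set: V i])
    (F_edge : forall i : nat, exists x y : V i, adj (F i) x y) :
  (exists G : nat -> sgraph nat,
      factorization rado G /\ forall i : nat, isomorphic (G i) (F i)) <->
  (forall i : nat, infinite_domination_number (F i)).
Proof.
split=> [[G [[Gfactor _] GF]] i|infF].
  exact/(isomorphic_infinite_domination (GF i))/rado_factor_infinite_domination.
(* Sufficiency reduces to graphs on [nat]: each [F i] is replaced by an isomorphic copy, which
   inherits both hypotheses. *)
have /choice[H HF] : forall i, exists H : sgraph nat, isomorphic H (F i).
  by move=> i; apply: isomorphic_nat.
have infH i : infinite_domination_number (H i).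
  exact: isomorphic_infinite_domination (isomorphic_sym (HF i)) (infF i).
have Hedge i : exists x y, adj (H i) x y.
  have [f [[g fK gK] fP]] := HF i; have [x [y xy]] := F_edge i.
  by exists (g x), (g y); apply/fP; rewrite !gK.
have [G [facG GH]] := rado_factorization_nat infH Hedge.
by exists G; split=> // i; apply: isomorphic_trans (GH i) (HF i).
Qed.
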